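(* There is a function $f\colon \mathbb{N}\times\mathbb{N}\to\mathbb{N}$ such that for all positive integers $K$ and $t$, every connected graph $G$ that does not contain $U_t$ as a $K$-fat minor satisfies $\mathrm{sipc}(G)\le f(K,t)$.
   Context: All graphs are finite, simple, undirected and unweighted; $\mathrm{dist}(x,y)$ is the shortest-path distance in $G$, and for vertex sets (or subgraphs) $X,Y$, $\mathrm{dist}(X,Y)=\min\{\mathrm{dist}(x,y): x\in X, y\in Y\}$. An isometric path is a shortest path between its end-vertices; for a vertex $v$, an isometric path is $v$-rooted if $v$ is one of its end-vertices. For a connected graph $G$ and $v\in V(G)$, $\mathrm{ipc}_v(G)$ is the minimum $k$ such that the vertex set of every isometric path of $G$ can be covered by $k$ many $v$-rooted isometric paths of $G$. The strong isometric path complexity is $\mathrm{sipc}(G)=\max_{v\in V(G)}\mathrm{ipc}_v(G)$. $U_t$ denotes the graph obtained from a path on $t$ vertices by adding a new vertex adjacent to all vertices of the path. For a positive integer $K$ and a graph $H$, a $K$-fat minor model of $H$ in $G$ is a collection of connected subgraphs $B_v$ ($v\in V(H)$, branch sets) and $P_e$ ($e\in E(H)$, branch paths) of $G$ such that $V(B_v)\cap V(P_e)\neq\emptyset$ whenever $v$ is an end-vertex of $e$, and every other pair of distinct members $X,Y$ of the collection satisfies $\mathrm{dist}(X,Y)\ge K$. $G$ contains $H$ as a $K$-fat minor if such a model exists. *)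

(* Defs.v *)
From mathcomp Require Import all_boot.

Set Implicit Arguments.
Unset Strict Implicit.
Unset Printing Implicit Defensive.

Record sgraph := SGraph {
  vertex :> finType;
  adj : rel vertex;
  adj_sym : symmetric adj;
  adj_irrefl : irreflexive adj }.

Record cgraph := CGraph {
  cgraph_sgraph :> sgraph;
  cgraph_nonempty : 0 < #|cgraph_sgraph|;
  cgraph_connected : forall x y : cgraph_sgraph, connect (@adj cgraph_sgraph) x y }.

Definition edges (H : sgraph) : {set {set H}} :=
  [set a | [exists x, exists y, adj x y && (a == [set x; y])]].

Definition walk_of_length (G : sgraph) (x y : G) (n : nat) : bool :=
  [exists p : n.-tuple G, path (@adj G) x p && (last x p == y)].

Lemma walk_exists (G : cgraph) (x y : G) : exists n, walk_of_length x y n.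
Proof.
have /connectP[p xp ->] := cgraph_connected x y.
by exists (size p); apply/existsP; exists (in_tuple p); rewrite xp eqxx.
Qed.

Definition dist (G : cgraph) (x y : G) : nat := ex_minn (walk_exists x y).

Lemma dist_walk (G : cgraph) (x y : G) :
  exists p, [/\ path (@adj G) x p, last x p = y & size p = dist x y].
Proof.
rewrite /dist; case: ex_minnP => n /existsP[p /andP[xp /eqP lp]] _.
by exists p; rewrite size_tuple.
Qed.

Lemma dist_min (G : cgraph) (x : G) (p : seq G) :
  path (@adj G) x p -> dist x (last x p) <= size p.
Proof.
move=> xp; rewrite /dist; case: ex_minnP => n _; apply.
by apply/existsP; exists (in_tuple p); rewrite xp eqxx.
Qed.

Lemma dist_lt_card (G : cgraph) (x y : G) : dist x y < #|G|.
Proof.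
have /connectP[p0 xp0 ->] := cgraph_connected x y.
case: (shortenP xp0) => p xp Up _; have := dist_min xp.
move=> /leq_ltn_trans; apply.
by have /card_uniqP szp := Up; rewrite -[_.+1]/(size (x :: p)) -szp max_card.
Qed.

(* The neutral element [#|G|] exceeds every distance in [G] ([dist_lt_card]), *)
(* so this is the minimum of [dist x y] whenever [X] and [Y] are nonempty;    *)
(* see [leq_set_dist].                                                        *)
Definition set_dist (G : cgraph) (X Y : {set G}) : nat :=
  \big[minn/#|G|]_(x in X) \big[minn/#|G|]_(y in Y) dist x y.

Lemma leq_bigminn (T : finType) (A : {set T}) (F : T -> nat) (m K : nat) :
  (K <= \big[minn/m]_(x in A) F x) = (K <= m) && [forall x in A, K <= F x].
Proof.
have -> : [forall x in A, K <= F x] =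
    all (fun x => (x \in A) ==> (K <= F x)) (index_enum T).
  by apply/forallP/allP => leK x; have := leK x; rewrite mem_index_enum // => ->.
elim: (index_enum T) => [|x s IHs]; first by rewrite big_nil andbT.
rewrite big_cons /=; case: (x \in A) => //=.
by rewrite leq_min IHs andbCA.
Qed.

Lemma leq_set_dist (G : cgraph) (X Y : {set G}) (K : nat) :
    X != set0 -> Y != set0 ->
  reflect {in X & Y, forall x y, K <= dist x y} (K <= set_dist X Y).
Proof.
rewrite /set_dist leq_bigminn => X0 Y0.
apply: (iffP andP) => [[_ /forall_inP leK] x y xX yY | leK].
  by move: (leK x xX); rewrite leq_bigminn => /andP[_ /forall_inP]; apply.
have [[x0 x0X] [y0 y0Y]] := (set0Pn _ X0, set0Pn _ Y0).
have leKG : K <= #|G|.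
  by apply: leq_trans (leK x0 y0 x0X y0Y) (ltnW (dist_lt_card _ _)).
split=> //; apply/forall_inP => x xX; rewrite leq_bigminn leKG /=.
by apply/forall_inP => y; apply: leK.
Qed.

(* Isometric paths are represented by their sequence of vertices. *)
Definition isometric (G : cgraph) (s : seq G) : bool :=
  if s is x :: p then path (@adj G) x p && (size p == dist x (last x p))
  else false.

Definition rooted_isometric (G : cgraph) (v : G) (s : seq G) : bool :=
  isometric s && ((head v s == v) || (last v s == v)).

Lemma isometric_size (G : cgraph) (s : seq G) : isometric s -> size s <= #|G|.
Proof.
by case: s => //= x p /andP[_ /eqP->]; apply: dist_lt_card.
Qed.

Lemma shortest_path_exists (G : cgraph) (v z : G) :
  exists s : {bseq #|G| of G}, rooted_isometric v s && (z \in val s).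
Proof.
have [p [vp lp sp]] := dist_walk v z.
have iso : isometric (v :: p) by rewrite /= vp lp sp eqxx.
exists (Bseq (isometric_size iso)).
by rewrite /rooted_isometric iso /= eqxx -lp mem_last.
Qed.

(* Bounded sequences make this decidable and lose nothing, by                 *)
(* [isometric_size]; see [coveredP] for the unbounded form.                   *)
Definition covered (G : cgraph) (v : G) (k : nat) : bool :=
  [forall s : {bseq #|G| of G}, isometric s ==>
    [exists Q : k.-tuple {bseq #|G| of G},
      all (fun q : {bseq #|G| of G} => rooted_isometric v q) Q
      && all (fun z => has (fun q : {bseq #|G| of G} => z \in val q) Q) s]].

Lemma coveredP (G : cgraph) (v : G) (k : nat) :
  reflect
    (forall s : seq G, isometric s ->
      exists Q : seq (seq G), [/\ size Q = k, all (rooted_isometric v) Q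
        & forall z, z \in s -> exists2 q, q \in Q & z \in q])
    (covered v k).
Proof.
apply: (iffP forall_inP) => [cov s iso | cov s iso].
  have /existsP[Q /andP[rQ /allP cQ]] := cov (Bseq (isometric_size iso)) iso.
  exists (map val Q); split; rewrite ?size_map ?size_tuple ?all_map //.
  move=> z /cQ /hasP[q qQ zq]; exists (val q) => //; exact: map_f.
have [Q [sQ rQ cQ]] := cov s iso.
have defQ : map val (pmap insub Q : seq {bseq #|G| of G}) = Q.
  rewrite pmap_filter; last exact: insubK.
  apply/all_filterP/allP => q /(allP rQ) /andP[/isometric_size le_q _].
  by rewrite insubT.
have szQ : size (pmap insub Q : seq {bseq #|G| of G}) == k.
  by rewrite -sQ -{2}defQ size_map.
apply/existsP; exists (Tuple szQ); apply/andP; split.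
  by rewrite -(all_map val (rooted_isometric v)) defQ.
apply/allP => z /cQ[q]; rewrite -{1}defQ => /mapP[q' q'Q ->] zq.
by apply/hasP; exists q'.
Qed.

Lemma covered_exists (G : cgraph) (v : G) : exists k, covered v k.
Proof.
pose q z := xchoose (shortest_path_exists v z).
have qP z : rooted_isometric v (q z) /\ z \in val (q z).
  exact/andP/(xchooseP (shortest_path_exists v z)).
exists #|G|; apply/forall_inP => s _.
apply/existsP; exists (codom_tuple q); apply/andP; split.
  by apply/allP => _ /codomP[z ->]; case: (qP z).
apply/allP => z _; apply/hasP; exists (q z); first exact: codom_f.
by case: (qP z).
Qed.

Definition ipc (G : cgraph) (v : G) : nat := ex_minn (covered_exists v).

Definition sipc (G : cgraph) : nat := \max_(v : G) ipc v.

Record subgraph (G : sgraph) := Subgraph {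
  sub_verts : {set G};
  sub_adj : rel G;
  sub_adj_sym : symmetric sub_adj;
  sub_adj_sub : forall x y, sub_adj x y ->
    [&& adj x y, x \in sub_verts & y \in sub_verts] }.

Definition connected_subgraph (G : sgraph) (S : subgraph G) : bool :=
  (sub_verts S != set0)
  && [forall x in sub_verts S, forall y in sub_verts S,
       connect (@sub_adj G S) x y].

Definition sub_dist (G : cgraph) (X Y : subgraph G) : nat :=
  set_dist (sub_verts X) (sub_verts Y).

(* [P] is only constrained on [edges H]; the end-vertices of an edge are its  *)
(* elements.                                                                  *)
Definition fat_minor_model (K : nat) (H : sgraph) (G : cgraph)
    (B : H -> subgraph G) (P : {set H} -> subgraph G) : Prop :=
  [/\ (forall v, connected_subgraph (B v))
        /\ (forall e, e \in edges H -> connected_subgraph (P e)),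
      forall v e, e \in edges H -> v \in e ->
        sub_verts (B v) :&: sub_verts (P e) != set0,
      forall u v, u != v -> K <= sub_dist (B u) (B v),
      forall e e', e \in edges H -> e' \in edges H -> e != e' ->
        K <= sub_dist (P e) (P e')
    & forall v e, e \in edges H -> v \notin e -> K <= sub_dist (B v) (P e)].

Definition fat_minor (K : nat) (H : sgraph) (G : cgraph) : Prop :=
  exists B P, @fat_minor_model K H G B P.

(* The graph U_t: [Some i] are the vertices of the path, [None] is the added  *)
(* vertex.                                                                    *)
Definition fan_adj (t : nat) (x y : option 'I_t) : bool :=
  match x, y with
  | Some i, Some j => (i.+1 == j :> nat) || (j.+1 == i :> nat)
  | None, None => false
  | _, _ => true
  end.

Lemma fan_adj_sym (t : nat) : symmetric (@fan_adj t).
Proof. by case=> [i|] [j|] //=; rewrite orbC. Qed.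

Lemma fan_adj_irrefl (t : nat) : irreflexive (@fan_adj t).
Proof. by case=> [i|] //=; rewrite orbb gtn_eqF. Qed.

Definition fan (t : nat) : sgraph := SGraph (@fan_adj_sym t) (@fan_adj_irrefl t).

(* Main.v *)
(* Let [p] be an isometric path and [h i] the distance from the root [v] to   *)
(* [p i]. Both [h i + i] and [i - h i] are nondecreasing in [i], and an       *)
(* interval of [p] on which one of them is constant lies on a [v]-rooted      *)
(* isometric path. Cutting [p] greedily into such intervals, either few       *)
(* suffice or there are many indices along which both quantities strictly     *)
(* increase; keep every [L]-th of them, [L = 6K + 1], as [c 0 < c 1 < ...],   *)
(* so that both quantities grow by at least [L] at each step. A vertex of [p] *)
(* that lies on a geodesic from [p (c k)] down to [v], up to an error less    *)
(* than [L], must then lie strictly between [p (c k.-1)] and [p (c k.+1)].    *)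
(* Around every fourth [c k] take a geodesic [Q] from [p (c k)] to [v] and    *)
(* let [Q s] be its last vertex at distance less than [K] from [p]. The path  *)
(* from [c k.-1] to [c k.+1] with [Q] up to [Q s] is a branch set, the next   *)
(* [K] steps of [Q] are its spoke, and the remainders of all the [Q]'s, which *)
(* meet at [v], form the hub of a [K]-fat fan.                                *)

(* The proof is a dichotomy on how the distance [h] to the root varies along a geodesic [p]. A
   stretch on which [h] always rises, or always falls, by one per step lies on a single rooted
   geodesic ([rooted_interval]). [slack L i j] says that the change of [h] from [i] to [j] falls
   short of [j - i] by at least [L] in absolute value; such deficits add up. Hence [cover_or_slack]:
   either [L * N] rooted paths cover [p], or [p] has [N] consecutive stretches of deficit [L].

   In the second case a geodesic from a cut point to [v] can come near [p] only between the two
   neighbouring cut points ([below_between], [own_window]). This keeps the initial parts of such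
   geodesics away from all the others ([descents_far]) and makes them leave [p] well before [v]
   ([touch_room]), so pieces of [p] and of these geodesics form a fat fan ([fan_of_slack]). *)
Require Import Defs.
From mathcomp Require Import all_boot.
From mathcomp Require Import zify.

Set Implicit Arguments.
Unset Strict Implicit.
Unset Printing Implicit Defensive.

(** * Distances and geodesics indexed by natural numbers *)

Section Distance.
Variable G : cgraph.
Implicit Types (x y z : G) (g : nat -> G).

Lemma distxx x : dist x x = 0.
Proof. by apply/eqP; rewrite -leqn0; apply: (@dist_min G x [::]). Qed.

Lemma dist_triangle y x z : dist x z <= dist x y + dist y z.
Proof.
have [p [xp lp <-]] := dist_walk x y; have [q [yq lq <-]] := dist_walk y z.
rewrite -size_cat -lq -lp -last_cat; apply: dist_min.
by rewrite cat_path xp lp.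
Qed.

Lemma dist_sym x y : dist x y = dist y x.
Proof.
suff le (u w : G) : dist u w <= dist w u by apply/eqP; rewrite eqn_leq !le.
have [p [wp lp <-]] := dist_walk w u.
rewrite -(size_belast w p) -(size_rev (belast w p)).
have {1}-> : w = last u (rev (belast w p)).
  by case: p wp lp => [|a p] //= _ _; rewrite rev_cons last_rcons.
apply: dist_min; rewrite -lp rev_path.
by rewrite (eq_path (e' := @adj G)) // => a b; apply: adj_sym.
Qed.

Lemma adj_dist x y : adj x y -> dist x y <= 1.
Proof. by move=> xy; apply: (@dist_min G x [:: y]); rewrite /= xy. Qed.

Lemma dist1_adj x y : dist x y = 1 -> adj x y.
Proof.
have [[|a [|b p]] [xp <- sp]] // := dist_walk x y; last by rewrite -sp.
  by rewrite distxx.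
by case/andP: xp.
Qed.

Definition geodesic g n :=
  forall i j, i <= j -> j <= n -> dist (g i) (g j) = j - i.

(** The steps bound every subinterval from above; a subinterval with ends too close would, by the
    triangle inequality, bring [g 0] and [g n] closer than [n]. *)
Lemma geodesic_steps g n :
    (forall i, i < n -> dist (g i) (g i.+1) <= 1) -> n <= dist (g 0) (g n) ->
  geodesic g n.
Proof.
move=> step len.
have ub i k : i + k <= n -> dist (g i) (g (i + k)) <= k.
  elim: k => [|k IHk] le_n; first by rewrite addn0 distxx.
  have := dist_triangle (g (i + k)) (g i) (g (i + k.+1)).
  have := step (i + k); rewrite addnS in le_n *.
  have := IHk (ltnW le_n); lia.
move=> i j le_ij le_jn.
have := ub 0 i; have := ub i (j - i); have := ub j (n - j).
have := dist_triangle (g i) (g 0) (g n); have := dist_triangle (g j) (g i) (g n).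
rewrite add0n !subnKC //; lia.
Qed.

Lemma path_nth_dist x y p i :
  path (@adj G) x p -> i < size p ->
  dist (nth y (x :: p) i) (nth y (x :: p) i.+1) <= 1.
Proof. by move=> /(pathP y) xp lt_ip; apply: adj_dist (xp i lt_ip). Qed.

Lemma walk_dist x y : walk_of_length x y (dist x y).
Proof. by rewrite /dist; case: ex_minnP. Qed.

Definition geo x y : nat -> G := nth y (x :: xchoose (existsP (walk_dist x y))).

Lemma geo0 x y : geo x y 0 = x.
Proof. by []. Qed.

Lemma geo_end x y : geo x y (dist x y) = y.
Proof.
rewrite /geo; case/andP: (xchooseP (existsP (walk_dist x y))).
move: (xchoose _) => p _ /eqP lp; rewrite -[in RHS]lp -nth_last /= size_tuple.
by case: (dist x y) p lp => [p|k p _] /=; [rewrite tuple0 | apply: set_nth_default; rewrite size_tuple].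
Qed.

Lemma geo_geodesic x y : geodesic (geo x y) (dist x y).
Proof.
apply: geodesic_steps; last by rewrite geo_end.
case/andP: (xchooseP (existsP (walk_dist x y))) => xp _ i lt_i.
by apply: path_nth_dist; rewrite ?size_tuple.
Qed.

Lemma isometric_mkseq g n : geodesic g n -> isometric (mkseq g n.+1).
Proof.
move=> geo_g; rewrite /mkseq /= size_map size_iota.
have -> : last (g 0) (map g (iota 1 n)) = g n.
  by rewrite (last_map g _ 0) -(nth_last 0) size_iota; case: n {geo_g} => // n;
     rewrite nth_iota.
rewrite geo_g // subn0 eqxx andbT.
apply/(pathP (g 0)) => i; rewrite size_map size_iota => lt_in.
rewrite (nth_map 0) ?size_iota // nth_iota // add1n.
have -> : nth (g 0) (g 0 :: map g (iota 1 n)) i = g i.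
  by rewrite -[_ :: _]/(map g (iota 0 n.+1)) (nth_map 0) ?size_iota ?nth_iota // ltnW.
by apply: dist1_adj; rewrite geo_g // subSnn.
Qed.

Lemma isometric_geodesic s : isometric s ->
  exists n g, geodesic g n /\ s = mkseq g n.+1.
Proof.
case: s => // x p /andP[xp /eqP sp]; exists (size p), (nth x (x :: p)).
split; last by rewrite -[(size p).+1]/(size (x :: p)) mkseq_nth.
apply: geodesic_steps => [i|]; first exact: path_nth_dist.
by rewrite -[X in dist _ (nth _ _ X)]/(size (x :: p)).-1 nth_last /= -sp.
Qed.

Lemma geodesic_cat f m g n : f m = g 0 -> m + n <= dist (f 0) (g n) ->
  geodesic f m -> geodesic g n ->
  geodesic (fun i => if i <= m then f i else g (i - m)) (m + n).
Proof.
move=> fg len geo_f geo_g; apply: geodesic_steps => [i|].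
  case: (ltngtP i m) => [lt_im|lt_mi|->] lt_i.
  - by rewrite geo_f // subSnn.
  - by rewrite subSn ?(ltnW lt_mi) // geo_g ?subSnn //; lia.
  - by rewrite fg subSn // subnn geo_g //; lia.
rewrite leq0n; case: (leqP (m + n) m) => [le_mn|_]; last by rewrite addKn.
have n0 : n = 0 by lia.
by move: len; rewrite n0 addn0 -fg.
Qed.

End Distance.

Lemma geodesic_shift (G : cgraph) (g : nat -> G) n i k :
  geodesic g n -> i + k <= n -> geodesic (fun l => g (i + l)) k.
Proof.
move=> geo_g le_n a b le_ab le_bk; rewrite geo_g ?subnDl ?leq_add2l //.
by apply: leq_trans le_n; rewrite leq_add2l.
Qed.

Lemma geodesic_rev (G : cgraph) (g : nat -> G) n k :
  geodesic g n -> k <= n -> geodesic (fun l => g (k - l)) k.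
Proof. by move=> geo_g le_n a b le_ab le_bk; rewrite dist_sym geo_g; lia. Qed.

(** * Covering a geodesic by rooted paths, or finding slack *)

Section Cover.
Variables (G : cgraph) (v : G).

(** Prepending a geodesic from [v] to [g 0] gives a walk of length [dist v (g k)], which is
    therefore isometric. *)
Lemma rooted_through (g : nat -> G) k :
    geodesic g k -> dist v (g k) = dist v (g 0) + k ->
  exists2 q, rooted_isometric v q & forall l, l <= k -> g l \in q.
Proof.
move=> geo_g hk; pose m := dist v (g 0).
pose f i := if i <= m then geo v (g 0) i else g (i - m).
have geo_f : geodesic f (m + k).
  by apply: geodesic_cat => //; [exact: geo_end | rewrite geo0 hk | exact: geo_geodesic].
exists (mkseq f (m + k).+1) => [|l le_l].
  by rewrite /rooted_isometric isometric_mkseq //= /f geo0 eqxx.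
apply/mapP; exists (m + l); first by rewrite mem_iota; lia.
rewrite /f; case: leqP => [le_m|_]; last by rewrite addKn.
have -> : l = 0 by lia.
by rewrite addn0 geo_end.
Qed.

Variables (p : nat -> G) (n : nat).
Hypothesis geo_p : geodesic p n.
Let h i := dist v (p i).

Lemma height_lip i j : i <= j -> j <= n ->
  (h j <= h i + (j - i)) * (h i <= h j + (j - i)).
Proof.
move=> le_ij le_jn; rewrite -(geo_p le_ij) //; split.
  exact: dist_triangle.
by rewrite dist_sym; apply: dist_triangle; rewrite dist_sym.
Qed.

Lemma rooted_interval i j : i <= j -> j <= n ->
    h j = h i + (j - i) \/ h i = h j + (j - i) ->
  exists2 q, rooted_isometric v q & forall l, i <= l -> l <= j -> p l \in q.
Proof.
move=> le_ij le_jn [hj|hi].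
  have [|/=|q rq cq] := @rooted_through (fun l => p (i + l)) (j - i).
  - by apply: geodesic_shift geo_p _; rewrite subnKC.
  - by rewrite subnKC // addn0.
  exists q => // l le_il le_lj; rewrite -(subnKC le_il); apply: cq; lia.
have [|/=|q rq cq] := @rooted_through (fun l => p (j - l)) (j - i).
- have geo_j := geodesic_rev geo_p le_jn.
  by move=> a b le_ab le_b; apply: geo_j => //; lia.
- by rewrite subKn // subn0.
exists q => // l le_il le_lj; rewrite -(subKn le_lj); apply: cq; lia.
Qed.

(* Both [h i + i] and [i - h i] increase by at least [L] from [i] to [j].     *)
Definition slack L i j :=
  (h j + i + L <= h i + j) && (h i + i + L <= h j + j).

(** The interval from [i] is extended up to the first [j] for which [slack 1 i j.+1] holds, and the
    search restarts at [j.+1]. Each path spent before reaching [n] thus pays for one unit of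
    slack. *)
Lemma greedy N i : i <= n ->
  (exists Q : seq (seq G), [/\ size Q <= N, all (rooted_isometric v) Q
     & forall l, i <= l -> l <= n -> exists2 q, q \in Q & p l \in q])
  \/ (exists a : nat -> nat, [/\ a 0 = i, forall k, k < N -> slack 1 (a k) (a k.+1)
     & forall k, k <= N -> a k <= n]).
Proof.
elim: N i => [|N IHN] i le_in; first by right; exists (fun=> i); split.
have [j [le_ij le_jn run stop]] : exists j, [/\ i <= j, j <= n,
    h j = h i + (j - i) \/ h i = h j + (j - i) & j < n -> slack 1 i j.+1].
  have ex : exists j, (i <= j) && ((j == n) || slack 1 i j.+1).
    by exists n; rewrite le_in eqxx.
  case: (ex_minnP ex) => j /andP[le_ij stop] minj; exists j.
  have le_jn : j <= n by apply: minj; rewrite le_in eqxx.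
  split=> //; last by move=> lt_jn; case/orP: stop => // /eqP eq_jn; lia.
  have [->|lt_ij] : i = j \/ i < j by lia.
    by left; rewrite subnn addn0.
  (* Minimality at [j.-1] refutes [slack 1 i j]; one of its halves fails, and the Lipschitz bound
     turns that failure into an equality. *)
  have [] := height_lip le_ij le_jn.
  have := minj j.-1; rewrite (_ : j.-1.+1 = j) /slack; lia.
have [q rq cq] := rooted_interval le_ij le_jn run.
have [eq_jn|lt_jn] : j = n \/ j < n by lia.
  left; exists [:: q]; split=> //=; first by rewrite rq.
  by move=> l le_il le_ln; exists q; rewrite ?mem_head ?cq ?eq_jn.
have [[Q [sQ rQ cQ]]|[a [a0 sa la]]] := IHN j.+1 lt_jn.
  left; exists (q :: Q); split=> //=; first by rewrite rq.
  move=> l le_il le_ln; have [le_lj|lt_jl] := leqP l j.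
    by exists q; rewrite ?mem_head ?cq.
  by have [q' q'Q pq'] := cQ l lt_jl le_ln; exists q'; rewrite // inE q'Q orbT.
right; exists (fun k => if k is k'.+1 then a k' else i); split=> //.
  by case=> [|k] lt_k; [rewrite a0; apply: stop | apply: sa].
by case=> [|k] // lt_k; apply: la.
Qed.

Lemma slack_iter a k L : (forall i, i < L -> slack 1 (a (k + i)) (a (k + i.+1))) ->
  slack L (a k) (a (k + L)).
Proof.
elim: L => [|L IHL] st; first by rewrite addn0 /slack; lia.
have := st L (ltnSn L).
have := IHL (fun i lt_i => st i (ltnW lt_i)).
rewrite /slack; lia.
Qed.

Lemma cover_or_slack N L :
  (exists Q : seq (seq G), [/\ size Q <= L * N, all (rooted_isometric v) Q
     & forall l, l <= n -> exists2 q, q \in Q & p l \in q])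
  \/ (exists c : nat -> nat, (forall k, k < N -> slack L (c k) (c k.+1))
     /\ forall k, k <= N -> c k <= n).
Proof.
have [[Q [sQ rQ cQ]]|[a [_ sa la]]] := @greedy (L * N) 0 (leq0n n).
  by left; exists Q; split=> // l; apply: cQ.
right; exists (fun k => a (L * k)); split=> k le_k.
  rewrite mulnSr; apply: slack_iter => i lt_i; rewrite addnS; apply: sa; nia.
by apply: la; rewrite leq_mul2l le_k orbT.
Qed.

End Cover.

Lemma sipc_leq (G : cgraph) (M : nat) : 0 < M ->
    (forall (v : G) (p : nat -> G) n, geodesic p n ->
       exists Q : seq (seq G), [/\ size Q <= M, all (rooted_isometric v) Q
         & forall l, l <= n -> exists2 q, q \in Q & p l \in q]) ->
  sipc G <= M.
Proof.
move=> M_gt0 cover; apply/bigmax_leqP => v _.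
rewrite /ipc; case: ex_minnP => k _; apply; apply/coveredP => s.
move=> /isometric_geodesic[n [p [geo_p ->]]].
have [Q [sQ rQ cQ]] := cover v p n geo_p.
(* [coveredP] asks for exactly [M] paths; the one-vertex path at [v] is the padding. *)
exists (Q ++ nseq (M - size Q) [:: v]); split.
- by rewrite size_cat size_nseq subnKC.
- by rewrite all_cat rQ all_nseq /rooted_isometric /= distxx !eqxx /= orbT.
- move=> z /mapP[l]; rewrite mem_iota add0n ltnS => /andP[_ le_l] ->.
  by have [q qQ zq] := cQ l le_l; exists q; rewrite // mem_cat qQ.
Qed.

(** * Fat fan models from families of vertex sets *)

Section Sets.
Variable G : cgraph.
Implicit Types (A B : {set G}) (x y z : G) (g : nat -> G).

Definition ind_adj A : rel G := [rel x y | [&& adj x y, x \in A & y \in A]].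

Lemma ind_adj_sym A : symmetric (ind_adj A).
Proof. by move=> x y; rewrite /ind_adj /= adj_sym [(x \in A) && _]andbC. Qed.

Definition induced A : subgraph G :=
  @Subgraph G A (ind_adj A) (@ind_adj_sym A) (fun x y xy => xy).

Lemma star_connected A z : z \in A ->
  (forall x, x \in A -> connect (ind_adj A) x z) -> connected_subgraph (induced A).
Proof.
move=> zA Az; apply/andP; split; first by apply/set0Pn; exists z.
apply/forall_inP => x xA; apply/forall_inP => y yA.
apply: connect_trans (Az x xA) _.
by rewrite (sym_connect_sym (@ind_adj_sym A)) Az.
Qed.

Definition seg g lo hi : {set G} :=
  [set x | [exists i : 'I_hi.+1, (lo <= i) && (x == g i)]].

Lemma segP g lo hi x :
  reflect (exists i, [/\ lo <= i, i <= hi & x = g i]) (x \in seg g lo hi).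
Proof.
rewrite inE; apply: (iffP existsP) => [[i /andP[le_i /eqP->]]|[i [le_i le_hi ->]]].
  by exists i; rewrite le_i -ltnS ltn_ord.
by exists (Ordinal (le_hi : i < hi.+1)); rewrite le_i eqxx.
Qed.

Lemma mem_seg g lo hi i : lo <= i -> i <= hi -> g i \in seg g lo hi.
Proof. by move=> le_i le_hi; apply/segP; exists i. Qed.

Lemma seg_connect g n lo hi A i j : geodesic g n -> hi <= n ->
  seg g lo hi \subset A -> lo <= i <= hi -> lo <= j <= hi ->
  connect (ind_adj A) (g i) (g j).
Proof.
move=> geo_g le_hi /subsetP sA.
wlog le_ij : i j / i <= j => [Hw hi_i hi_j|].
  have [/Hw|/ltnW/Hw] := leqP i j; first exact.
  by rewrite (sym_connect_sym (@ind_adj_sym A)); apply.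
move=> /andP[lo_i _] /andP[_ j_hi]; rewrite -(subnKC le_ij) in j_hi *.
elim: (j - i) j_hi => [|k IHk] j_hi; first by rewrite addn0.
rewrite addnS in j_hi *; apply: connect_trans (IHk (ltnW j_hi)) (connect1 _).
rewrite /ind_adj /= !sA ?mem_seg //; try lia.
by rewrite dist1_adj // geo_g // ?subSnn // (leq_trans j_hi).
Qed.

Lemma seg_connected g n lo hi : geodesic g n -> hi <= n -> lo <= hi ->
  connected_subgraph (induced (seg g lo hi)).
Proof.
move=> geo_g le_hi le_lo; apply: (@star_connected _ (g lo)); first exact: mem_seg.
move=> _ /segP[i [lo_i i_hi ->]].
by apply: (seg_connect geo_g le_hi); rewrite // ?lo_i ?i_hi ?leqnn ?le_lo.
Qed.

Definition far K A B := forall x y, x \in A -> y \in B -> K <= dist x y.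

Lemma farC K A B : far K A B -> far K B A.
Proof. by move=> fAB x y xB yA; rewrite dist_sym fAB. Qed.

Lemma farUl K A B C : far K A C -> far K B C -> far K (A :|: B) C.
Proof. by move=> fAC fBC x y; rewrite inE => /orP[/fAC|/fBC]; apply. Qed.

Lemma far_sub_dist K A B : connected_subgraph (induced A) ->
  connected_subgraph (induced B) -> far K A B -> K <= sub_dist (induced A) (induced B).
Proof. by move=> /andP[A0 _] /andP[B0 _] fAB; apply/leq_set_dist. Qed.

Lemma edges_fan t e : e \in edges (fan t) ->
  (exists i : 'I_t, e = [set None; Some i]) \/
  (exists i j : 'I_t, j = i.+1 :> nat /\ e = [set Some i; Some j]).
Proof.
rewrite inE => /existsP[x /existsP[y /andP[]]].
case: x y => [i|] [j|] //= ij /eqP->.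
- right; case/orP: ij => /eqP ij; first by exists i, j.
  by exists j, i; rewrite setUC.
- by left; exists i; rewrite setUC.
- by left; exists j.
Qed.

Lemma fan_minor K t (hub : {set G}) (B S E : nat -> {set G}) :
    connected_subgraph (induced hub) ->
    (forall i, i < t -> connected_subgraph (induced (B i))) ->
    (forall i, i < t -> connected_subgraph (induced (S i))) ->
    (forall i, i.+1 < t -> connected_subgraph (induced (E i))) ->
    (forall i, i < t -> hub :&: S i != set0) ->
    (forall i, i < t -> B i :&: S i != set0) ->
    (forall i, i.+1 < t -> B i :&: E i != set0) ->
    (forall i, i.+1 < t -> B i.+1 :&: E i != set0) ->
    (forall i, i < t -> far K hub (B i)) ->
    (forall i, i.+1 < t -> far K hub (E i)) ->
    (forall i j, i < t -> j < t -> i != j -> far K (B i) (B j)) ->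
    (forall i j, i < t -> j < t -> i != j -> far K (B i) (S j)) ->
    (forall i j, i < t -> j < t -> i != j -> far K (S i) (S j)) ->
    (forall i j, i < t -> j.+1 < t -> i != j -> i != j.+1 -> far K (B i) (E j)) ->
    (forall i j, i < t -> j.+1 < t -> far K (S i) (E j)) ->
    (forall i j, i.+1 < t -> j.+1 < t -> i != j -> far K (E i) (E j)) ->
  fat_minor K (fan t) G.
Proof.
move=> cH cB cS cE HS BS BE BE' fHB fHE fBB fBS fSS fBE fSE fEE.
pose b (x : fan t) := if x is Some i then B i else hub.
(* Edges are unordered sets, so the branch path is a union over indices read off [e]; for an edge of
   the fan exactly one index qualifies. *)
pose P (e : {set fan t}) : {set G} :=
  if None \in e then \bigcup_(i < t | Some i \in e) S i
  else \bigcup_(i < t | [exists j : 'I_t, [&& j == i.+1 :> nat, Some i \in e & Some j \in e]]) E i.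
have PS (i : 'I_t) : P [set None; Some i] = S i.
  rewrite /P !inE eqxx /= (big_pred1 i) // => j.
  by rewrite !inE.
have PE (i j : 'I_t) : j = i.+1 :> nat -> P [set Some i; Some j] = E i.
  move=> ij; rewrite /P !inE /= (big_pred1 i) // => k.
  apply/existsP/eqP => [[l]|->]; last by exists j; rewrite !inE ij !eqxx orbT.
  rewrite !inE => /and3P[/eqP lk /orP[]/eqP[ek] /orP[]/eqP[el]];
  by apply/val_inj; move: (congr1 val ek) (congr1 val el) => /=; lia.
exists (fun u => induced (b u)), (fun e => induced (P e)).
have cb (x : fan t) : connected_subgraph (induced (b x)) by case: x => [i|]; [apply: cB|].
have cP e : e \in edges (fan t) -> connected_subgraph (induced (P e)).
  case/edges_fan => [[i ->]|[i [j [ij ->]]]]; first by rewrite PS; apply: cS.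
  by rewrite (PE _ _ ij); apply: cE; rewrite -ij.
split=> //.
- move=> x e /edges_fan[[i ->]|[i [j [ij ->]]]] /=; rewrite !inE.
    by case/orP => /eqP->; rewrite PS; [apply: HS | apply: BS].
  have lt_i : i.+1 < t by rewrite -ij.
  by case/orP => /eqP->; rewrite (PE _ _ ij) /= ?ij; [apply: BE | apply: BE'].
- move=> x y xy; apply: far_sub_dist => //.
  case: x y xy => [i|] [j|] //= xy; first exact: fBB.
    by apply: farC; apply: fHB.
  exact: fHB.
- move=> e e' He He' ee'; apply: far_sub_dist; [exact: cP | exact: cP |].
  case/edges_fan: He ee' => [[i ->]|[i [j [ij ->]]]];
  case/edges_fan: He' => [[i' ->]|[i' [j' [ij' ->]]]] ee';
  rewrite ?PS ?(PE _ _ ij) ?(PE _ _ ij').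
  + by apply: fSS => //; apply: contraNneq ee' => /val_inj->.
  + by apply: fSE; rewrite // -ij'.
  + by apply: farC; apply: fSE; rewrite // -ij.
  + apply: fEE; rewrite -?ij -?ij' //; apply: contraNneq ee' => /val_inj ii'.
    have -> : j = j' by apply/val_inj; rewrite /= ij ij' ii'.
    by rewrite ii'.
- move=> x e He xe; apply: far_sub_dist; [exact: cb | exact: cP |].
  case/edges_fan: He xe => [[i ->]|[i [j [ij ->]]]];
  rewrite ?PS ?(PE _ _ ij) !inE negb_or => /andP[].
    by case: x => [k|] //= _ ki; apply: fBS.
  have lt_i : i.+1 < t by rewrite -ij.
  case: x => [k|] /= ki kj; last exact: fHE.
  by apply: fBE => //; rewrite -ij.
Qed.
End Sets.

(** * The fan produced by many stretches of slack *)

Section Fan.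
Variables (G : cgraph) (v : G) (p : nat -> G) (n K M : nat) (c : nat -> nat).
Hypotheses (K_gt0 : 0 < K) (geo_p : geodesic p n).
Let h x := dist v x.
Let a k := p (c k).
Hypothesis slack_c : forall k, k < M -> slack v p (6 * K).+1 (c k) (c k.+1).
Hypothesis c_le : forall k, k <= M -> c k <= n.

Lemma c_gap k l : k < l -> l <= M -> c k + K < c l.
Proof.
elim: l => // l IHl; rewrite ltnS leq_eqVlt => /predU1P[->|lt_kl] lt_lM;
  have := slack_c lt_lM; rewrite /slack; first lia.
by have := IHl lt_kl (ltnW lt_lM); lia.
Qed.

(* [q] lies on a geodesic from [x] down to [v], up to an error [S]. *)
Let below S x q := dist x q + h q <= h x + S.

(** If [j <= c k], then [dist (a k.+1) (p j) + h (p j)] is at least [c k.+1 - c k + h (a k)], which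
    the first half of [slack] puts [6 * K + 1] or more above [h (a k.+1)]. From [c k.+2] on, the
    second half does the same. *)
Lemma below_between k j : k.+1 < M -> j <= n -> below (6 * K) (a k.+1) (p j) ->
  c k < j < c k.+2.
Proof.
move=> lt_kM le_jn; rewrite /below /a /h => bel.
have lt_kM' : k < M by apply: ltnW.
have le1 := c_gap (ltnSn k) lt_kM'; have le2 := c_gap (ltnSn k.+1) lt_kM.
have := c_le lt_kM; have := slack_c lt_kM; have := slack_c lt_kM'; rewrite /slack.
move=> s1 s2 ln.
have [lt_kj|le_jk] := ltnP (c k) j; last first.
  move: bel; rewrite dist_sym geo_p; try lia.
  have [] := height_lip v geo_p le_jk; lia.
have [//|le_kj] := ltnP j (c k.+2).
move: bel; rewrite geo_p; try lia.
have [] := height_lip v geo_p le_kj le_jn; lia.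
Qed.

Definition descent x : nat -> G := geo x v.

Lemma descent_geodesic x : geodesic (descent x) (h x).
Proof. by rewrite /h dist_sym; apply: geo_geodesic. Qed.

Lemma descent_end x : descent x (h x) = v.
Proof. by rewrite /h dist_sym; apply: geo_end. Qed.

Lemma descent_dist x s : s <= h x -> dist x (descent x s) = s.
Proof.
by move=> le_s; rewrite -{1}(geo0 x v) (descent_geodesic (leq0n s)) // subn0.
Qed.

Lemma descent_height x s : s <= h x -> h (descent x s) = h x - s.
Proof.
move=> le_s; rewrite /h -{1}(descent_end x) dist_sym.
exact: descent_geodesic.
Qed.

Definition touch x :=
  \max_(s < (h x).+1 | [exists j : 'I_n.+1, dist (descent x s) (p j) < K]) s.

Lemma touch_near k : k <= M ->
  touch (a k) <= h (a k) /\
  exists j, j <= n /\ dist (descent (a k) (touch (a k))) (p j) < K.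
Proof.
move=> le_k; rewrite /touch.
have [|s /existsP[j near] ->] :=
  @eq_bigmax_cond _ [pred s : 'I_(h (a k)).+1 |
     [exists j : 'I_n.+1, dist (descent (a k) s) (p j) < K]] (@nat_of_ord _).
  (* Index 0 qualifies because the descent starts on [p] and [K] is positive, so the maximum is
     attained. *)
  apply/card_gt0P; exists ord0; apply/existsP.
  by exists (Ordinal (c_le le_k : c k < n.+1)); rewrite /descent geo0 distxx.
by split; [rewrite -ltnS | exists j; rewrite -ltnS].
Qed.

Lemma touch_far x s j : touch x < s -> s <= h x -> j <= n ->
  K <= dist (descent x s) (p j).
Proof.
move=> lt_s le_s le_j; rewrite leqNgt; apply: contraL lt_s => near.
rewrite -leqNgt; apply: (@leq_bigmax_cond _ _ (@nat_of_ord _) (Ordinal (le_s : s < (h x).+1))).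
by apply/existsP; exists (Ordinal (le_j : j < n.+1)).
Qed.

Lemma height_dist x y : h x <= h y + dist x y.
Proof. by rewrite (dist_sym x); apply: dist_triangle. Qed.

Lemma own_window k s j : k.+1 < M -> s <= h (a k.+1) -> j <= n ->
  dist (descent (a k.+1) s) (p j) < K -> c k < j < c k.+2.
Proof.
move=> lt_k le_s le_j near; apply: below_between => //; rewrite /below.
have := descent_dist le_s; have := descent_height le_s.
have := dist_triangle (descent (a k.+1) s) (a k.+1) (p j).
have := height_dist (p j) (descent (a k.+1) s); rewrite (dist_sym (p j)).
lia.
Qed.

(** Otherwise, going down from [a l.+1], across to the other descent, along it to its touch point
    and over to [p] would put [p j] below [a l.+1], hence in two disjoint windows. The two jumps
    cost less than [K] each in length and in height; climbing back from [s] to the touch point costs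
    at most [2 * K] more, whence the error [6 * K]. Only one descent is bounded, since the
    remainders all meet at [v]. *)
Lemma descents_far k l s r : k.+1 < M -> l.+1 < M -> k.+1 < l \/ l.+1 < k ->
  s <= touch (a k.+1) + K -> s <= h (a k.+1) -> r <= h (a l.+1) ->
  K <= dist (descent (a k.+1) s) (descent (a l.+1) r).
Proof.
move=> lt_k lt_l kl le_st le_s le_r; rewrite leqNgt; apply/negP => near.
have [le_t [j [le_j near_j]]] := touch_near (ltnW lt_k).
have win_k := own_window lt_k le_t le_j near_j.
set t := touch _ in le_st le_t near_j; set x := a k.+1; set y := a l.+1.
have : below (6 * K) y (p j).
  have dst : dist (descent x s) (descent x t) <= maxn s t - minn s t.
    have [le_st'|/ltnW le_ts] := leqP s t.
      by rewrite (descent_geodesic le_st').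
    by rewrite dist_sym (descent_geodesic le_ts).
  have := descent_dist le_r; have := descent_height le_r.
  have := descent_height le_s; have := descent_height le_t.
  have := dist_triangle (descent y r) y (p j).
  have := dist_triangle (descent x s) (descent y r) (p j).
  have := dist_triangle (descent x t) (descent x s) (p j).
  have := height_dist (p j) (descent x t); rewrite (dist_sym (p j)).
  have := height_dist (descent x s) (descent y r).
  rewrite (dist_sym (descent y r) (descent x s)) /below -/x -/y.
  by move: dst near near_j le_r le_s le_t le_st; rewrite -/x -/y; lia.
move/(below_between lt_l le_j) => win_l.
case: kl => lt_kl.
  have : c k.+2 <= c l; last by lia.
  move: lt_kl; rewrite leq_eqVlt => /predU1P[->//|lt_kl].
  by have := c_gap lt_kl (ltnW (ltnW lt_l)); lia.
have : c l.+2 <= c k; last by lia.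
move: lt_kl; rewrite leq_eqVlt => /predU1P[->//|lt_lk].
by have := c_gap lt_lk (ltnW (ltnW lt_k)); lia.
Qed.

(** A touch point within [K] of [v] gives some [p j] within [2 * K] of [v]. Such a vertex is below
    every cut point up to [4 * K], so it lies in the window of [a k.+3] as well, which is disjoint
    from that of [a k.+1]. *)
Lemma touch_room k : k.+3 < M -> touch (a k.+1) + K <= h (a k.+1).
Proof.
move=> lt_k; have lt_k1 : k.+1 < M by lia.
have [le_t [j [le_j near_j]]] := touch_near (ltnW lt_k1).
have win_k := own_window lt_k1 le_t le_j near_j.
rewrite leqNgt; apply/negP => lt_h.
have : below (6 * K) (a k.+3) (p j).
  have := descent_height le_t.
  have := height_dist (p j) (descent (a k.+1) (touch (a k.+1))).
  have := dist_triangle v (a k.+3) (p j).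
  rewrite (dist_sym _ v) (dist_sym (p j)) /below /h; move: lt_h; rewrite /h; lia.
move/(below_between lt_k le_j); lia.
Qed.

Lemma path_segs_far lo hi lo' hi' : hi + K <= lo' -> hi' <= n ->
  far K (seg p lo hi) (seg p lo' hi').
Proof.
move=> gap le_n _ _ /segP[i [_ le_i ->]] /segP[j [le_j le_j' ->]].
by rewrite geo_p; lia.
Qed.

Lemma descent_path_far k lo hi lo' hi' : k.+1 < M -> hi <= h (a k.+1) ->
    hi' <= n -> hi' <= c k \/ c k.+2 <= lo' ->
  far K (seg (descent (a k.+1)) lo hi) (seg p lo' hi').
Proof.
move=> lt_k le_hi le_n out _ _ /segP[s [_ le_s ->]] /segP[j [le_j le_j' ->]].
rewrite leqNgt; apply/negP => near.
have := own_window lt_k (leq_trans le_s le_hi) (leq_trans le_j' le_n) near; lia.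
Qed.

Lemma descent_segs_far k l lo hi lo' hi' : k.+1 < M -> l.+1 < M ->
    k.+1 < l \/ l.+1 < k -> hi <= touch (a k.+1) + K -> hi <= h (a k.+1) ->
    hi' <= h (a l.+1) ->
  far K (seg (descent (a k.+1)) lo hi) (seg (descent (a l.+1)) lo' hi').
Proof.
move=> lt_k lt_l kl le_t le_h le_h' _ _ /segP[s [_ le_s ->]] /segP[r [_ le_r ->]].
by apply: descents_far => //; lia.
Qed.

(** [W m] is exactly the window of the descent from [y m], and [E m] joins it to [W m.+1]. With
    period 4, non-incident pieces of [p] are separated by a step of [c], longer than [K] by
    [c_gap]. *)
Lemma fan_of_slack t : 0 < t -> 4 * t < M -> fat_minor K (fan t) G.
Proof.
move=> t_gt0 le_M.
pose y m := a (4 * m).+2.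
pose W m := seg p (c (4 * m).+1) (c (4 * m).+3).
pose T m := seg (descent (y m)) 0 (touch (y m)).
pose S m := seg (descent (y m)) (touch (y m)) (touch (y m) + K).
pose E m := seg p (c (4 * m).+3) (c (4 * m.+1).+1).
pose U m := seg (descent (y m)) (touch (y m) + K) (h (y m)).
pose hub := \bigcup_(m < t) U m.
have hubP x : x \in hub -> exists2 m, m < t & x \in U m.
  by case/bigcupP => m _ xU; exists m.
have Usub m : m < t -> U m \subset hub.
  by move=> lt_m; apply: (bigcup_sup (Ordinal lt_m)).
have room m : m < t -> touch (y m) + K <= h (y m).
  by move=> lt_m; apply: touch_room; lia.
have le_t m : m < t -> touch (y m) <= h (y m) by move=> /room; lia.
have len k : k <= 4 * t -> c k <= n by move=> le_k; apply: c_le; lia.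
have lt_c k l : k < l -> l <= 4 * t -> c k + K < c l.
  by move=> lt_kl le_l; apply: c_gap; lia.
have geo_y m : geodesic (descent (y m)) (h (y m)) by apply: descent_geodesic.
have v_hub m : m < t -> v \in U m.
  by move=> lt_m; rewrite -(descent_end (y m)) mem_seg ?room.
have mid m : m < t -> [/\ c (4 * m).+1 <= c (4 * m).+2, c (4 * m).+2 <= c (4 * m).+3,
    c (4 * m).+3 <= n & c (4 * m).+3 + K < c (4 * m).+4].
  move=> lt_m; have := @lt_c (4 * m).+1 (4 * m).+2; have := @lt_c (4 * m).+2 (4 * m).+3.
  have := @lt_c (4 * m).+3 (4 * m).+4; have := len (4 * m).+3; split; lia.
have next m m' : m < m' -> m' < t -> c (4 * m).+4 <= c (4 * m') /\ c (4 * m') + K < c (4 * m').+1.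
  move=> lt_m lt_m'; have := @lt_c (4 * m') (4 * m').+1; split; last lia.
  have [->|lt'] : 4 * m' = (4 * m).+4 \/ (4 * m).+4 < 4 * m' by lia.
    by [].
  by have := @lt_c (4 * m).+4 (4 * m') lt'; lia.
have far_UP m lo hi : m < t -> hi <= n -> far K (U m) (seg p lo hi).
  move=> lt_m le_n _ _ /segP[s [lt_s le_s ->]] /segP[j [_ le_j ->]].
  by apply: touch_far; lia.
have far_WW m m' : m < m' -> m' < t -> far K (W m) (W m').
  move=> lt_m lt_m'; have [le1 lt2] := next m m' lt_m lt_m'.
  have [] := mid m (ltn_trans lt_m lt_m'); have [] := mid m' lt_m'.
  by move=> *; apply: path_segs_far; lia.
have far_DP m m' hi : m < t -> m' < t -> m != m' -> hi <= h (y m) ->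
    forall lo, far K (seg (descent (y m)) lo hi) (W m').
  move=> lt_m lt_m' mm' le_hi lo.
  have [] := mid m lt_m; have [] := mid m' lt_m' => *.
  apply: descent_path_far => //; first lia.
  have [lt|lt] : m < m' \/ m' < m by lia.
    by right; have [] := next m m' lt lt_m'; lia.
  by left; have [] := next m' m lt lt_m; lia.
have far_DE m m' hi : m < t -> m'.+1 < t -> hi <= h (y m) ->
    forall lo, far K (seg (descent (y m)) lo hi) (E m').
  move=> lt_m lt_m' le_hi lo; have [] := mid m lt_m => *.
  have [] := mid m' (ltnW lt_m'); have [] := next m' m'.+1 (ltnSn m') lt_m' => *.
  have [] := mid m'.+1 lt_m' => *.
  apply: descent_path_far => //; [lia | lia |].
  have [lt|[->|[->|lt]]] : m < m' \/ m = m' \/ m = m'.+1 \/ m'.+1 < m by lia.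
  - by right; have [] := next m m' lt (ltnW lt_m'); lia.
  - by right.
  - by left.
  - by left; have [] := next m'.+1 m lt lt_m; lia.
have far_DD m m' lo hi lo' hi' : m < t -> m' < t -> m != m' ->
    hi <= touch (y m) + K -> hi <= h (y m) -> hi' <= h (y m') ->
    far K (seg (descent (y m)) lo hi) (seg (descent (y m')) lo' hi').
  by move=> *; apply: descent_segs_far => //; lia.
have in_E m : m.+1 < t -> c (4 * m).+3 <= c (4 * m.+1).+1 /\ c (4 * m.+1).+1 <= n.
  move=> lt_m; have [] := mid m (ltnW lt_m); have [] := mid m.+1 lt_m.
  by have [] := next m m.+1 (ltnSn m) lt_m; lia.
apply: (@fan_minor _ K t hub (fun m => W m :|: T m) S E).
- apply: (@star_connected _ _ v).
    by apply: (subsetP (Usub 0 t_gt0)); apply: v_hub.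
  move=> _ /hubP[m lt_m /segP[s [le_s le_s' ->]]].
  rewrite -(descent_end (y m)); apply: (seg_connect (geo_y m) (leqnn _) (Usub m lt_m)).
    by rewrite le_s.
  by rewrite room /=.
- move=> m lt_m; have [le1 le2 le3 _] := mid m lt_m.
  apply: (@star_connected _ _ (y m)).
    by rewrite inE (mem_seg p le1 le2).
  move=> x; rewrite inE => /orP[]/segP[i [lo_i hi_i ->]].
    apply: (seg_connect geo_p le3); first exact: subsetUl.
      by rewrite lo_i.
    by rewrite le1.
  rewrite -[X in connect _ _ X]/(descent (y m) 0).
  by apply: (@seg_connect _ _ _ 0 _ _ _ _ (geo_y m) (le_t m lt_m)) => //; apply: subsetUr.
- by move=> m lt_m; apply: (seg_connected (geo_y m)); rewrite ?room ?leq_addr.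
- by move=> m /in_E[le1 le2]; apply: (seg_connected geo_p).
- move=> m lt_m; apply/set0Pn; exists (descent (y m) (touch (y m) + K)).
  rewrite inE mem_seg ?leq_addr // andbT.
  by apply: (subsetP (Usub m lt_m)); rewrite mem_seg ?room.
- move=> m lt_m; apply/set0Pn; exists (descent (y m) (touch (y m))).
  by apply/setIP; split; [apply/setUP; right|]; apply: mem_seg; rewrite ?leq_addr.
- move=> m lt_m; have [le1 le2] := in_E m lt_m; have [] := mid m (ltnW lt_m) => *.
  apply/set0Pn; exists (p (c (4 * m).+3)).
  by apply/setIP; split; [apply/setUP; left|]; apply: mem_seg; lia.
- move=> m lt_m; have [le1 le2] := in_E m lt_m; have [] := mid m.+1 lt_m => *.
  apply/set0Pn; exists (p (c (4 * m.+1).+1)).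
  by apply/setIP; split; [apply/setUP; left|]; apply: mem_seg; lia.
(* [U m'] avoids [W m] by maximality of [touch]. It avoids [T m] by [descents_far] when the indices
   differ, and otherwise because the [K] steps of [S m] separate them on one geodesic. *)
- move=> m lt_m; apply: farC; apply: farUl; apply: farC => x z /hubP[m' lt_m' xU].
    by have [_ _ le_n _] := mid m lt_m; apply: (far_UP m' _ _ lt_m' le_n).
  have [eq_m|ne_m] := eqVneq m' m.
    move: xU; rewrite eq_m => /segP[r [le_r le_r' ->]] /segP[s [_ le_s ->]].
    by rewrite dist_sym geo_y; lia.
  move=> zT; rewrite dist_sym; apply: (far_DD m m' _ _ _ _ lt_m lt_m' _ _ _ _ z x zT xU);
    rewrite ?leq_addr ?le_t // eq_sym //.
- move=> m lt_m x z /hubP[m' lt_m' xU]; have [_ le_n] := in_E m lt_m.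
  exact: (far_UP m' _ _ lt_m' le_n x z xU).
- move=> m m' lt_m lt_m' ne_m; apply: farUl; apply: farC; apply: farUl.
  + have [lt|lt] : m' < m \/ m < m' by lia.
      exact: far_WW.
    by apply: farC; apply: far_WW.
  + by apply: far_DP; rewrite ?le_t // eq_sym.
  + by apply: farC; apply: far_DP; rewrite ?le_t.
  + by apply: far_DD; rewrite ?leq_addr ?le_t // eq_sym.
- move=> m m' lt_m lt_m' ne_m; apply: farUl.
    by apply: farC; apply: far_DP; rewrite ?room // eq_sym.
  by apply: far_DD; rewrite ?leq_addr ?le_t ?room.
- by move=> m m' lt_m lt_m' ne_m; apply: far_DD; rewrite ?room.
- move=> m m' lt_m lt_m' ne1 ne2; apply: farUl; last by apply: far_DE; rewrite ?le_t.
  have [] := mid m lt_m; have [] := in_E m' lt_m'; have [] := mid m' (ltnW lt_m') => *.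
  have [] := next m' m'.+1 (ltnSn m') lt_m' => *.
  have [lt|lt] : m < m' \/ m'.+1 < m by lia.
    by have [] := next m m' lt (ltnW lt_m'); move=> *; apply: path_segs_far; lia.
  have [] := mid m'.+1 lt_m'; have [] := next m'.+1 m lt lt_m => *.
  by apply: farC; apply: path_segs_far; lia.
- by move=> m m' lt_m lt_m'; apply: far_DE; rewrite ?room.
- move=> m m'; wlog lt : m m' / m < m' => [Hw lt_m lt_m' ne|lt_m lt_m' _].
    have [lt|lt] : m < m' \/ m' < m by lia.
      exact: Hw.
    by apply: farC; apply: Hw => //; rewrite eq_sym.
  have [] := in_E m lt_m; have [] := in_E m' lt_m'; have [] := mid m' (ltnW lt_m') => *.
  have [] := mid m.+1 (leq_ltn_trans lt (ltnW lt_m')).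
  have [] := next m m' lt (ltnW lt_m') => *.
  have le_c : c (4 * m.+1).+1 <= c (4 * m').+1.
    have [->//|lt'] : m.+1 = m' \/ m.+1 < m' by lia.
    by have [] := next m.+1 m' lt' (ltnW lt_m'); lia.
  by apply: path_segs_far => //; have := @lt_c (4 * m').+1 (4 * m').+3; lia.
Qed.

End Fan.

Theorem theorem1p2 :
  exists f : nat -> nat -> nat,
    forall K t : nat, 0 < K -> 0 < t ->
      forall G : cgraph, ~ fat_minor K (fan t) G -> sipc G <= f K t.
Proof.
(* Slack [6 * K + 1] beats the error in [below_between]; [4 * t + 1] stretches give four per path
   vertex of the fan and one spare for [touch_room]. *)
exists (fun K t => (6 * K).+1 * (4 * t).+1) => K t K_gt0 t_gt0 G no_fan.
apply: sipc_leq => // v p n geo_p.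
have [//|[c [slack_c c_le]]] := cover_or_slack v geo_p (4 * t).+1 (6 * K).+1.
by case: no_fan; apply: (fan_of_slack K_gt0 geo_p slack_c c_le).
Qed.
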